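(* Let $B=(X,\underline{\ast},\overline{\ast})$ be a biquandle and let $\mathcal{Q}(B)=(X,* )$ be its associated quandle. For $y\in X$ let $\beta_y\colon X\to X$ be the map $\beta_y(x)=x\,\overline{\ast}\,y$. Then the family of mappings $\{\beta_y\mid y\in X\}$ is a biquandle structure on $\mathcal{Q}(B)$.
   Context: A quandle is a set $Q$ with a binary operation $*$ such that (1) $x*x=x$ for all $x$; (2) for every $y$ the map $S_y(x)=x*y$ is a bijection of $Q$; (3) $(x*y)*z=(x*z)*(y*z)$ for all $x,y,z$. $Aut(Q)$ is the group of bijective quandle homomorphisms $Q\to Q$. A biquandle is a set $B$ with two binary operations $\underline{\ast},\overline{\ast}$ such that (1) $x\,\underline{\ast}\,x=x\,\overline{\ast}\,x$ for all $x$; (2) the maps $\alpha_y(x)=x\,\underline{\ast}\,y$ and $\beta_y(x)=x\,\overline{\ast}\,y$ (for every $y\in B$) are bijections of $B$, and the map $S(x,y)=(y\,\overline{\ast}\,x,\;x\,\underline{\ast}\,y)$ is a bijection of $B\times B$; (3) for all $x,y,z\in B$: $(x\,\underline{\ast}\,y)\,\underline{\ast}\,(z\,\underline{\ast}\,y)=(x\,\underline{\ast}\,z)\,\underline{\ast}\,(y\,\overline{\ast}\,z)$, $(x\,\underline{\ast}\,y)\,\overline{\ast}\,(z\,\underline{\ast}\,y)=(x\,\overline{\ast}\,z)\,\underline{\ast}\,(y\,\overline{\ast}\,z)$, and $(x\,\overline{\ast}\,y)\,\overline{\ast}\,(z\,\overline{\ast}\,y)=(x\,\overline{\ast}\,z)\,\overline{\ast}\,(y\,\underline{\ast}\,z)$.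 Write $x\,\overline{\ast}^{-1}y=\beta_y^{-1}(x)$. For a biquandle $B=(X,\underline{\ast},\overline{\ast})$, the associated (underlying) quandle $\mathcal{Q}(B)=(X,* )$ has operation $x*y=(x\,\underline{\ast}\,y)\,\overline{\ast}^{-1}y$ (this is known to be a quandle). A biquandle structure on a quandle $Q=(X,* )$ is a family of automorphisms $\{\beta_y\mid y\in X\}\subset Aut(Q)$ such that (1) $\beta_{\beta_y(x*y)}\beta_y=\beta_{\beta_x(y)}\beta_x$ for every $x,y\in X$; (2) the map $y\mapsto\beta_y(y)$ is a bijection of $X$. *)

(* Defs.v *)
From mathcomp Require Import all_boot.
From mathcomp Require Import boolp classical_sets functions.

Set Implicit Arguments.
Unset Strict Implicit.
Unset Printing Implicit Defensive.

Declare Scope quandle_scope.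
Delimit Scope quandle_scope with quandle.
Local Open Scope quandle_scope.

Record quandle := Quandle {
  qcarrier :> Type;
  qop : qcarrier -> qcarrier -> qcarrier;
  qopxx : forall x, qop x x = x;
  qop_bij : forall y, bijective (fun x => qop x y);
  qop_distr : forall x y z,
    qop (qop x y) z = qop (qop x z) (qop y z)
}.

Notation "x <| y" := (qop x y)
  (at level 40, left associativity) : quandle_scope.

Definition quandle_automorphism (Q : quandle) (f : Q -> Q) : Prop :=
  bijective f /\ forall x y : Q, f (x <| y) = f x <| f y.

(* [under x y] and [over x y] are x \underline{*} y and x \overline{*} y. *)
Record biquandle := Biquandle {
  bcarrier :> Type;
  under : bcarrier -> bcarrier -> bcarrier;
  over : bcarrier -> bcarrier -> bcarrier;
  under_overxx : forall x, under x x = over x x;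
  under_bij : forall y, bijective (fun x => under x y);
  over_bij : forall y, bijective (fun x => over x y);
  switch_bij :
    bijective (fun p : bcarrier * bcarrier => (over p.2 p.1, under p.1 p.2));
  under_under : forall x y z,
    under (under x y) (under z y) = under (under x z) (over y z);
  under_over : forall x y z,
    over (under x y) (under z y) = under (over x z) (over y z);
  over_over : forall x y z,
    over (over x y) (over z y) = over (over x z) (under y z)
}.

Notation "x \_* y" := (under x y)
  (at level 40, left associativity) : quandle_scope.
Notation "x \^* y" := (over x y)
  (at level 40, left associativity) : quandle_scope.

Section AssociatedQuandle.
Variable B : biquandle.
Implicit Types x y z : B.

Definition over_inv x y : B :=
  (bijection_of_bijective (over_bij y))^-1%FUN x.

Lemma over_invK y : cancel (fun x => over_inv x y) (fun x => x \^* y).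
Proof.
by move=> x; apply: (invK (f := bijection_of_bijective (over_bij y))); rewrite inE.
Qed.

Lemma overK y : cancel (fun x => x \^* y) (fun x => over_inv x y).
Proof. by move=> x; apply: (bij_inj (over_bij y)); rewrite over_invK. Qed.

Definition assoc_op x y : B := over_inv (x \_* y) y.

Lemma assoc_opxx x : assoc_op x x = x.
Proof. by rewrite /assoc_op under_overxx overK. Qed.

Lemma assoc_op_bij y : bijective (fun x => assoc_op x y).
Proof.
apply: (bij_comp (f := fun x => over_inv x y) _ (under_bij y)).
by exists (fun x => x \^* y); [apply: over_invK | apply: overK].
Qed.

Lemma assoc_op_distr x y z :
  assoc_op (assoc_op x y) z = assoc_op (assoc_op x z) (assoc_op y z).
Proof.
have opE a b : assoc_op a b \^* b = a \_* b by apply: over_invK.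
have overD a b c : assoc_op a b \^* c = assoc_op (a \^* c) (b \^* c).
  by apply: (bij_inj (over_bij (b \^* c))); rewrite opE over_over opE under_over.
apply: (bij_inj (over_bij z)); rewrite opE overD !opE.
by apply: (bij_inj (over_bij (y \_* z))); rewrite opE under_over opE under_under.
Qed.

Definition assoc_quandle : quandle :=
  Quandle assoc_opxx assoc_op_bij assoc_op_distr.

End AssociatedQuandle.

(* [beta y x] is the value at x of the member of the family indexed by y. *)
Definition biquandle_structure (Q : quandle) (beta : Q -> Q -> Q) : Prop :=
  [/\ forall y, quandle_automorphism (beta y),
      forall x y,
        beta (beta y (x <| y)) \o beta y =1 beta (beta x y) \o beta x
    & bijective (fun y => beta y y)].

(* Main.v *)
Require Import Defs.
From mathcomp Require Import all_boot.
Local Open Scope quandle_scope.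

(** Since [assoc_op x y \^* y = x \_* y], condition (1) is the third exchange law, and the last two
    laws make each [\^* z] an automorphism. Condition (2) holds because the switch map restricts to
    a bijection of the diagonal. *)

Lemma assoc_op_over (B : biquandle) (x y : B) : assoc_op x y \^* y = x \_* y.
Proof. exact: over_invK. Qed.

Lemma over_assoc_op (B : biquandle) (x y z : B) :
  assoc_op x y \^* z = assoc_op (x \^* z) (y \^* z).
Proof.
(* Acting by [y \^* z] cancels the inverse hidden in each [assoc_op]. *)
apply: (bij_inj (over_bij (y \^* z))).
by rewrite assoc_op_over over_over assoc_op_over under_over.
Qed.

(* With [c] the common value, the third exchange law gives
   (z \^* x) \^* c = (z \^* y) \^* c for all z, so x and y act alike by [over];
   hence x \_* y = y \^* x = y \^* y = y \_* y. *)
Lemma switch_diag (B : biquandle) (x y : B) : y \^* x = x \_* y -> x = y.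
Proof.
move=> yx_xy.
have over_xy z : z \^* x = z \^* y.
  by apply: (bij_inj (over_bij (y \^* x))); rewrite over_over yx_xy.
by apply: (bij_inj (under_bij y)); rewrite -yx_xy over_xy under_overxx.
Qed.

(** By [switch_diag], the preimage of [(c, c)] under the switch is some [(y, y)]; this [y] is the
    inverse image of [c]. *)
Lemma over_diag_bij (B : biquandle) : bijective (fun y : B => y \^* y).
Proof.
have [g switchK gK] := switch_bij B.
exists (fun c => (g (c, c)).1) => [y | c].
  by have /= := switchK (y, y); rewrite under_overxx => ->.
have := gK (c, c); case: (g (c, c)) => x y /= [yx xy].
by rewrite -[in RHS]yx (switch_diag B x y) // yx xy.
Qed.

Theorem theorem2p5 (B : biquandle) :
  @biquandle_structure (assoc_quandle B) (fun y x : B => x \^* y).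
Proof.
split=> [y | x y z /= |]; last exact: over_diag_bij.
- by split; [apply: over_bij | move=> x z; apply: over_assoc_op].
- by rewrite assoc_op_over over_over.
Qed.
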